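(* Work in the setting of the context: units are assigned to experiments $A_i\in\{0,1,*\}$, and Assumptions (A1)--(A5) and consistency hold. Let $f$ be a probability distribution on the finite set $\mathcal{S}$ of values of the auxiliary treatments, fixed independently of treatment, mediator and covariates. For treatment levels $t,t'\in\mathcal{T}$ define $$\alpha_f(t,t')=\sum_{s\in\mathcal{S}}\mathbb{E}\left[Y_i(t,M_i(t',s),s)\right]f(s).$$ Then $\alpha_f(t,t')$ is identified from observable quantities by $$\alpha_f(t,t')=\sum_{s,x,m}\mu_Y(t,m,x,s)\; e_m(t',x,s)\;\Pr(X_i=x)\,f(s),$$ where $$\mu_Y(t,m,x,s)=\mathbb{E}[Y_i\mid T_i=t,M_i=m,X_i=x,S_i=s,A_i=1],$$ $$e_m(t',x,s)=\Pr(M_i=m\mid T_i=t',X_i=x,S_i=s,A_i=0).$$ In particular, if $S_i$ is randomly assigned (i.e. independent of $X_i$ jointly with all potential outcomes), then $$\alpha(t,t')=\mathbb{E}\left[Y_i(t,M_i(t',S_i),S_i)\right]=\sum_{x,s,m}\mu_Y(t,m,x,s)\;e_m(t',x,s)\;\Pr(X_i=x,S_i=s).$$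
   Context: All of the following are random variables for a generic unit $i$. The covariate $X_i$, the focal treatment $T_i\in\mathcal{T}$, the mediator $M_i\in\mathcal{M}$ and the auxiliary treatments $S_i\in\mathcal{S}$ take values in finite sets, and $A_i\in\{0,1,*\}$ is the experiment indicator. Sums over $x$ run over values with $\Pr(X_i=x)>0$, sums over $m$ run over $\mathcal{M}$, and sums over $s$ run over $\mathcal{S}$. There are real-valued, integrable potential outcomes $Y_i(t,m,s,a)$ and $\mathcal{M}$-valued potential mediators $M_i(t,s,a)$, for $t\in\mathcal{T}$, $m\in\mathcal{M}$, $s\in\mathcal{S}$ and $a\in\{0,1,*\}$. When $A_i=1$ (the ''$Y(T,M)$-experiment''), $(T_i,M_i,S_i)$ are all set by randomization and $Y_i$ is observed. When $A_i=0$ (the ''$M(T)$-experiment''), $(T_i,S_i)$ are randomized and the unit's own mediator value $M_i$ is observed. (The experiment $A_i=*$ randomizes $(T_i,S_i)$ and observes $Y_i$; it is not used in the formula.) Assumptions: (A2) Manipulation exclusion restriction: $Y_i(t,m,s,a)=Y_i(t,m,s,a')$ and $M_i(t,s,a)=M_i(t,s,a')$ for all $t,m,s,a,a'$. The argument $a$ is therefore dropped and we write $Y_i(t,m,s)$ and $M_i(t,s)$. (A1) Principal ignorability: for all $t,m,s$, $Y_i(t,m,s)\perp G_i\mid X_i$, where the principal stratum $G_i=(M_i(t,s))_{t\in\mathcal{T},s\in\mathcal{S}}$ is the collection of all potential mediators of unit $i$. (A3) For all $t,m,s$: $Y_i(t,m,s)\perp A_i\mid X_i$ and $M_i(t,s)\perp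 A_i\mid X_i$; and $\Pr(A_i=a\mid X_i)\in(0,1)$ for every $a$. (A4) For all $t,m,s$: $Y_i(t,m,s)\perp (T_i,S_i,M_i)\mid X_i,A_i=1$; and $\Pr(T_i=t,S_i=s,M_i=m\mid X_i,A_i=1)\in(0,1)$. (A5) For all $t,s$: $M_i(t,s)\perp (T_i,S_i)\mid X_i,A_i=0$; and $\Pr(T_i=t,S_i=s\mid X_i,A_i=0)\in(0,1)$. Consistency: if $A_i=1$ then $Y_i=Y_i(T_i,M_i,S_i)$; if $A_i=0$ then $M_i=M_i(T_i,S_i)$. *)

(* Defs.v *)
From HB Require Import structures.
From mathcomp Require Import all_boot all_order all_algebra.
From mathcomp Require Import all_classical all_reals all_analysis.

Set Implicit Arguments.
Unset Strict Implicit.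
Unset Printing Implicit Defensive.

Import Order.TTheory GRing.Theory Num.Theory.
Import numFieldNormedType.Exports.

Local Open Scope classical_set_scope.
Local Open Scope ring_scope.

(* Experiment labels 0, 1 and the star. *)
Inductive exper : Type := Exp0 | Exp1 | ExpStar.

Section Probability.
Context {d : measure_display} {Omega : measurableType d} {R : realType}.
Variable P : probability Omega R.
Implicit Types E F C : set Omega.

Definition pr E : R := fine (P E).

(* Elementary conditional probability and expectation given an event; they are
   only meaningful when the conditioning event has positive probability (and
   are 0 otherwise). *)
Definition cpr E F : R := pr (E `&` F) / pr F.

Definition cexp (Y : Omega -> R) F : \bar R :=
  ((\int[P]_(w in F) (Y w)%:E) * ((pr F)^-1)%:E)%E.

Definition ev {V : Type} (X : Omega -> V) (x : V) : set Omega := X @^-1` [set x].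

(* sigma(X) for X valued in a finite set with the power-set sigma-algebra. *)
Definition sigma_fin {V : Type} (X : Omega -> V) : set (set Omega) :=
  preimage_set_system setT X setT.

(* sigma(Y) for a real random variable Y (Borel sigma-algebra on R). *)
Definition sigma_real (Y : Omega -> R) : set (set Omega) :=
  preimage_set_system setT Y measurable.

Definition fin_rv {V : Type} (X : Omega -> V) : Prop :=
  sigma_fin X `<=` measurable.

(* [cindep C X F1 F2]: F1 and F2 are independent conditionally on X, on the
   event C (take C = setT for conditioning on X alone). *)
Definition cindep (C : set Omega) {V : Type} (X : Omega -> V)
    (F1 F2 : set (set Omega)) : Prop :=
  forall x, 0 < pr (C `&` ev X x) ->
  forall E1 E2, F1 E1 -> F2 E2 ->
  cpr (E1 `&` E2) (C `&` ev X x)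
  = cpr E1 (C `&` ev X x) * cpr E2 (C `&` ev X x).

Definition indep (F1 F2 : set (set Omega)) : Prop :=
  forall E1 E2, F1 E1 -> F2 E2 -> pr (E1 `&` E2) = pr E1 * pr E2.

End Probability.

(* The random variables attached to a generic unit.  The observed outcome and
   mediator are total functions; their values are constrained (by consistency)
   only in the experiments in which they are used. *)
Record unit_data {d : measure_display} {Omega : measurableType d}
    {R : realType} (P : probability Omega R) (XX TT MM SS : finType) := UnitData {
  covX : Omega -> XX;
  trtT : Omega -> TT;
  medM : Omega -> MM;
  auxS : Omega -> SS;
  expA : Omega -> exper;
  outY : {RV P >-> R};
  Ypot : TT -> MM -> SS -> exper -> {RV P >-> R};
  Mpot : TT -> SS -> exper -> Omega -> MM;
  covX_rv : fin_rv covX;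
  trtT_rv : fin_rv trtT;
  medM_rv : fin_rv medM;
  auxS_rv : fin_rv auxS;
  expA_rv : fin_rv expA;
  Mpot_rv : forall t s a, fin_rv (Mpot t s a);
  Ypot_integrable : forall t m s a,
    P.-integrable setT (EFin \o (Ypot t m s a : Omega -> R))
}.

Section Setting.
Context {d : measure_display} {Omega : measurableType d} {R : realType}.
Context {P : probability Omega R} {XX TT MM SS : finType}.
Variable U : unit_data P XX TT MM SS.

Definition exclusion_restriction : Prop :=
  (forall t m s a a' w, Ypot U t m s a w = Ypot U t m s a' w) /\
  (forall t s a a' w, Mpot U t s a w = Mpot U t s a' w).

(* Y(t,m,s) and M(t,s): the experiment argument is dropped; under
   [exclusion_restriction] the label chosen here is immaterial. *)
Definition Yp (t : TT) (m : MM) (s : SS) : Omega -> R := Ypot U t m s ExpStar.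
Definition Mp (t : TT) (s : SS) : Omega -> MM := Mpot U t s ExpStar.

Definition stratum (w : Omega) : {ffun TT * SS -> MM} :=
  [ffun p => Mp p.1 p.2 w].

Definition principal_ignorability : Prop :=
  forall t m s,
    cindep P setT (covX U) (sigma_real (Yp t m s)) (sigma_fin stratum).

Definition experiment_assignment : Prop :=
  [/\ forall t m s,
        cindep P setT (covX U) (sigma_real (Yp t m s)) (sigma_fin (expA U)),
      forall t s,
        cindep P setT (covX U) (sigma_fin (Mp t s)) (sigma_fin (expA U)) &
      forall x a, 0 < pr P (ev (covX U) x) ->
        0 < cpr P (ev (expA U) a) (ev (covX U) x) < 1].

Definition randomization_exp1 : Prop :=
  (forall t m s,
     cindep P (ev (expA U) Exp1) (covX U) (sigma_real (Yp t m s))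
       (sigma_fin (fun w => (trtT U w, auxS U w, medM U w)))) /\
  (forall x t s m, 0 < pr P (ev (expA U) Exp1 `&` ev (covX U) x) ->
     0 < cpr P (ev (trtT U) t `&` ev (auxS U) s `&` ev (medM U) m)
               (ev (expA U) Exp1 `&` ev (covX U) x) < 1).

Definition randomization_exp0 : Prop :=
  (forall t s,
     cindep P (ev (expA U) Exp0) (covX U) (sigma_fin (Mp t s))
       (sigma_fin (fun w => (trtT U w, auxS U w)))) /\
  (forall x t s, 0 < pr P (ev (expA U) Exp0 `&` ev (covX U) x) ->
     0 < cpr P (ev (trtT U) t `&` ev (auxS U) s)
               (ev (expA U) Exp0 `&` ev (covX U) x) < 1).

Definition consistency : Prop :=
  (forall w, expA U w = Exp1 ->
     outY U w = Yp (trtT U w) (medM U w) (auxS U w) w) /\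
  (forall w, expA U w = Exp0 -> medM U w = Mp (trtT U w) (auxS U w) w).

Definition is_distribution (f : SS -> R) : Prop :=
  (forall s, 0 <= f s) /\ \sum_s f s = 1.

Definition alpha_f (f : SS -> R) (t t' : TT) : \bar R :=
  (\sum_s 'E_P[(fun w => Yp t (Mp t' s w) s w)] * (f s)%:E)%E.

Definition alpha (t t' : TT) : \bar R :=
  ('E_P[(fun w => Yp t (Mp t' (auxS U w) w) (auxS U w) w)])%E.

Definition mu_Y (t : TT) (m : MM) (x : XX) (s : SS) : \bar R :=
  cexp P (outY U)
    (ev (trtT U) t `&` ev (medM U) m `&` ev (covX U) x `&` ev (auxS U) s
       `&` ev (expA U) Exp1).

Definition e_med (m : MM) (t : TT) (x : XX) (s : SS) : R :=
  cpr P (ev (medM U) m)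
    (ev (trtT U) t `&` ev (covX U) x `&` ev (auxS U) s `&` ev (expA U) Exp0).

(* The sigma-algebra generated jointly by X, all Y(t,m,s) and all M(t,s). *)
Definition sigma_potential : set (set Omega) :=
  <<s [set E | [\/ sigma_fin (covX U) E,
                   exists t m s, sigma_real (Yp t m s) E |
                   exists t s, sigma_fin (Mp t s) E]] >>.

Definition aux_randomly_assigned : Prop :=
  indep P (sigma_fin (auxS U)) sigma_potential.

End Setting.

(* Main.v *)
Require Import Defs.
From mathcomp Require Import all_boot all_order all_algebra.
From mathcomp Require Import all_classical all_reals all_analysis.
From mathcomp Require Import measurable_realfun.

Import Order.TTheory GRing.Theory Num.Theory.
Import numFieldNormedType.Exports.
Local Open Scope classical_set_scope.
Local Open Scope ring_scope.

(** Conditional independence of [Y] and an event [G] given [K] says that the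
    law of [Y] under [P (. | G `&` K)] is its law under [P (. | K)]; hence the
    two conditional means agree.  Applied to [G = {A = 1}] and then to
    [G = {T = t, S = s, M = m}] this turns mu_Y(t,m,x,s) into
    E[Y(t,m,s) | X = x], and in the same way e_m(t',x,s) is
    Pr(M(t',s) = m | X = x).  Principal ignorability makes the product of the
    two the contribution of the cell {X = x, M(t',s) = m} to
    E[Y(t,M(t',s),s)], and it remains to sum over the cells. *)

(** Follows from the nonnegative case on positive and negative parts; integrability keeps their
    difference from being [+oo - +oo]. *)
Lemma integral_mscale {d} {T : measurableType d} {R : realType}
    (mu : measure T R) (D : set T) (k : {nonneg R}) (f : T -> \bar R) :
  measurable D -> mu.-integrable D f ->
  (\int[mscale k mu]_(x in D) f x = k%:num%:E * \int[mu]_(x in D) f x)%E.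
Proof.
move=> mD intf; have mf := measurable_int _ intf.
rewrite [LHS]integralE [in RHS]integralE.
rewrite (ge0_integral_mscale _ mD k (measurable_funepos mf))//.
rewrite (ge0_integral_mscale _ mD k (measurable_funeneg mf))//.
rewrite [RHS]muleBr//; apply: fin_num_adde_defl; rewrite fin_numN.
by apply: integrable_fin_num => //; exact: integrable_funeneg.
Qed.

(** * Finite-valued random variables *)

Section FiniteRandomVariables.
Context {d : measure_display} {Omega : measurableType d}.

Lemma sigma_fin_preimage {V : Type} (Z : Omega -> V) (A : set V) :
  sigma_fin Z (Z @^-1` A).
Proof. by exists A => //; rewrite setTI. Qed.

Lemma sigma_fin_ev {V : Type} (Z : Omega -> V) (v : V) : sigma_fin Z (ev Z v).
Proof. exact: sigma_fin_preimage. Qed.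

Lemma measurable_ev {V : Type} (Z : Omega -> V) (v : V) :
  fin_rv Z -> measurable (ev Z v).
Proof. by apply; exact: sigma_fin_ev. Qed.

(** Each preimage is a finite union over the values of [Z]. This makes M(t',S), a potential mediator
    read at a random index, a random variable. *)
Lemma fin_rv_bind {V : finType} {W : Type} (Z : Omega -> V)
    (F : V -> Omega -> W) :
  fin_rv Z -> (forall v, fin_rv (F v)) -> fin_rv (fun w => F (Z w) w).
Proof.
move=> mZ mF _ [B _ <-]; rewrite setTI.
have -> : (fun w => F (Z w) w) @^-1` B
    = \bigcup_(v in [set: V]) (ev Z v `&` F v @^-1` B).
  apply/seteqP; split=> [w BF|w [v _ [<-]]//].
  by exists (Z w).
apply: fin_bigcup_measurable => [|v _]; first exact: finite_finset.
apply: measurableI; first exact: measurable_ev.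
by apply: mF; exact: sigma_fin_preimage.
Qed.

Lemma fin_rv_pair {V : finType} {W : Type} (Z : Omega -> V) (Z' : Omega -> W) :
  fin_rv Z -> fin_rv Z' -> fin_rv (fun w => (Z w, Z' w)).
Proof.
move=> mZ mZ'; apply: (fin_rv_bind Z (fun v w => (v, Z' w))) => // v.
move=> _ [B _ <-]; apply: mZ'; rewrite setTI.
exact: (sigma_fin_preimage _ (pair v @^-1` B)).
Qed.

Lemma ev_pair {V W : Type} (Z : Omega -> V) (Z' : Omega -> W) v v' :
  ev (fun w => (Z w, Z' w)) (v, v') = ev Z v `&` ev Z' v'.
Proof. by apply/seteqP; split=> [w [<- <-]|w [<- <-]]. Qed.

End FiniteRandomVariables.

(** * Integrals and conditional means over events *)

Section Conditioning.
Context {d : measure_display} {Omega : measurableType d} {R : realType}.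
Variable P : probability Omega R.
Implicit Types (Y : Omega -> R) (E F G K C : set Omega).

Lemma prE E : measurable E -> P E = (pr P E)%:E.
Proof. by move=> mE; rewrite fineK// fin_num_measure. Qed.

Lemma pr_ge0 E : 0 <= pr P E.
Proof. exact: fine_ge0. Qed.

(** On [ev Z v] the random index is frozen at [v], so a nested outcome reduces to integrals of the
    fixed outcomes [F v]. *)
Lemma integral_partition {V : finType} (Z : Omega -> V) (F : V -> Omega -> R) :
  fin_rv Z -> (forall v, P.-integrable setT (EFin \o F v)) ->
  (\int[P]_w (F (Z w) w)%:E = \sum_v \int[P]_(w in ev Z v) (F v w)%:E)%E.
Proof.
move=> mZ intF.
under eq_bigr do rewrite integral_mkcond.
rewrite -integral_sum//; last first.
  move=> v; have mZv := measurable_ev Z v mZ; apply/(integrable_mkcond _ mZv).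
  exact: integrableS (intF v).
apply: eq_integral => w _; rewrite (bigD1 (Z w))//= patchT ?inE//.
rewrite big1 ?adde0// => v vZ; rewrite patchN//.
by apply/negP; rewrite inE /ev/= => /esym/eqP; exact/negP.
Qed.

(* The measures [E |-> P (E `&` G)] and [c P (E `&` K)] agree on sigma(Y).  The
   law of [Y] under the first one is, away from 0, the law of [Y \1_G]. *)
Lemma integral_proportional Y G K (c : R) :
  measurable G -> measurable K -> 0 <= c ->
  P.-integrable setT (EFin \o Y) ->
  (forall E, sigma_real Y E -> pr P (E `&` G) = c * pr P (E `&` K)) ->
  (\int[P]_(w in G) (Y w)%:E = c%:E * \int[P]_(w in K) (Y w)%:E)%E.
Proof.
move=> mG mK c0 intY prop.
have mY : measurable_fun setT Y by exact/measurable_EFinP/(measurable_int _ intY).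
(* Restricting [Y] to an event by zero sends the outside mass to 0, where the integrand [y]
   vanishes, so deleting 0 loses nothing. *)
pose D := ~` [set 0 : R].
have mD : measurable D by exact: measurableC.
have law H : measurable H -> exists Z : {RV P >-> R},
    [/\ (\int[P]_(w in H) (Y w)%:E = \int[distribution P Z]_(y in D) y%:E)%E,
        (distribution P Z).-integrable D EFin &
        forall A, A `<=` D -> distribution P Z A = P (Y @^-1` A `&` H)].
  move=> mH; have mZ : measurable_fun setT (Y \_ H).
    by apply/(measurable_restrictT _ mH); exact: measurable_funS mY.
  have intZ : P.-integrable setT (EFin \o (Y \_ H)).
    rewrite -restrict_EFin.
    by apply/(integrable_mkcond _ mH); exact: integrableS intY.
  have mZD : measurable ((Y \_ H) @^-1` D).
    by rewrite -[X in measurable X]setTI; exact: mZ.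
  have intZD : P.-integrable ((Y \_ H) @^-1` D) (EFin \o (Y \_ H)).
    exact: integrableS intZ.
  exists (mfun_Sub (mem_set mZ)); split => [||A AD].
  - rewrite /distribution (integral_pushforward mZ)//.
    rewrite [LHS]integral_mkcond [RHS]integral_mkcond; apply: eq_integral => w _.
    rewrite [in RHS]/patch /=; case: ifPn => [_|].
      by rewrite /patch; case: ifP.
    by rewrite notin_setE /D /= /patch; case: ifP => // _ /contrapT ->.
  - exact: (integrable_pushforward mZ).
  - rewrite /distribution /pushforward; congr (P _).
    apply/seteqP; split=> w /=; rewrite /patch; case: ifPn.
    + by rewrite inE.
    + by move=> _ /AD /(_ erefl).
    + by move=> _ [].
    + by rewrite notin_setE => ? [].
have [ZG [-> _ lawG]] := law _ mG; have [ZK [-> intK lawK]] := law _ mK.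
(* It suffices to compare the two laws on measurable subsets of [D], where both are probabilities of
   events of sigma(Y) cut by [G] or [K]. *)
rewrite (@eq_measure_integral _ _ _ _ (mscale (NngNum c0) (distribution P ZK))).
  by rewrite integral_mscale.
move=> A mA AD; rewrite [LHS]lawG// [RHS](congr1 (mule c%:E) (lawK A AD)).
have mYA : measurable (Y @^-1` A) by rewrite -[X in measurable X]setTI; exact: mY.
rewrite !prE; [|exact: measurableI..].
by rewrite -EFinM; congr EFin; apply: prop; exists A => //; rewrite setTI.
Qed.

(** Independence allows [integral_proportional] with constant [cpr P G K], which cancels against the
    same factor in the probability of the intersection of [G] and [K]. *)
Lemma cexp_indep Y G K :
  measurable G -> measurable K -> 0 < cpr P G K ->
  P.-integrable setT (EFin \o Y) ->
  (forall E, sigma_real Y E -> cpr P (E `&` G) K = cpr P E K * cpr P G K) ->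
  cexp P Y (G `&` K) = cexp P Y K.
Proof.
move=> mG mK GK intY indep.
(* Were [pr P K] zero, [cpr P G K] would be 0 by the convention on inverting 0, against [GK]. *)
have K0 : pr P K != 0.
  by apply: contraTneq GK => K0; rewrite /cpr K0 invr0 mulr0 ltxx.
have GKE : pr P (G `&` K) = cpr P G K * pr P K by rewrite /cpr divfK.
rewrite /cexp (@integral_proportional Y (G `&` K) K (cpr P G K))//.
- rewrite GKE.
  have /fineK <- : (\int[P]_(w in K) (Y w)%:E)%E \is a fin_num.
    by apply: integrable_fin_num => //; exact: integrableS intY.
  rewrite -!EFinM; congr EFin; rewrite invfM mulrACA mulfV ?mul1r//.
  by rewrite gt_eqF.
- exact: measurableI.
- exact: ltW.
- move=> E EY; rewrite setIA -(divfK K0 (pr P (E `&` G `&` K))).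
  by rewrite -/(cpr P (E `&` G) K) indep// mulrAC /cpr divfK// mulrC.
Qed.

(** The counterpart of [cexp_indep] for events, needed for the mediator probabilities. *)
Lemma cpr_indep E G K :
  0 < cpr P G K -> cpr P (E `&` G) K = cpr P E K * cpr P G K ->
  cpr P E (G `&` K) = cpr P E K.
Proof.
move=> GK indep.
have K0 : pr P K != 0.
  by apply: contraTneq GK => K0; rewrite /cpr K0 invr0 mulr0 ltxx.
have GKE : pr P (G `&` K) = cpr P G K * pr P K by rewrite /cpr divfK.
rewrite [LHS]/cpr setIA GKE -(divfK K0 (pr P (E `&` G `&` K))).
rewrite -/(cpr P (E `&` G) K) indep -(mulrA _ _ (pr P K)) mulfK//.
by rewrite mulf_neq0// gt_eqF.
Qed.

Lemma cexp_fin_num Y K :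
  measurable K -> P.-integrable setT (EFin \o Y) -> cexp P Y K \is a fin_num.
Proof.
move=> mK intY; rewrite /cexp fin_numM//.
by apply: integrable_fin_num => //; exact: integrableS intY.
Qed.

Lemma cexpK Y K : pr P K != 0 ->
  (cexp P Y K * (pr P K)%:E = \int[P]_(w in K) (Y w)%:E)%E.
Proof. by move=> K0; rewrite /cexp -muleA -EFinM mulVf// mule1. Qed.

Lemma eq_cexp Y Y' K : {in K, Y =1 Y'} -> cexp P Y K = cexp P Y' K.
Proof.
by move=> YY'; congr (_ * _)%E; apply: eq_integral => w /YY' ->.
Qed.

(** Disposes of covariate values of probability zero: the partition into cells includes them, the
    identification formula leaves them out. *)
Lemma integral_null Y K N :
  measurable K -> measurable N -> N `<=` K -> pr P K = 0 ->
  P.-integrable setT (EFin \o Y) -> (\int[P]_(w in N) (Y w)%:E = 0)%E.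
Proof.
move=> mK mN NK K0 intY; apply: null_set_integral => //.
  by apply: (measurable_int P); exact: integrableS intY.
by apply: (subset_measure0 mN mK NK); rewrite [LHS](prE K mK) K0.
Qed.

End Conditioning.

(** * Observable quantities as potential ones *)

Section Identification.
Context {d : measure_display} {Omega : measurableType d} {R : realType}.
Context {P : probability Omega R} {XX TT MM SS : finType}.
Variable U : unit_data P XX TT MM SS.

Let mX x : measurable (ev (covX U) x).
Proof. exact/measurable_ev/covX_rv. Qed.

Let mA a : measurable (ev (expA U) a).
Proof. exact/measurable_ev/expA_rv. Qed.

Let mS s : measurable (ev (auxS U) s).
Proof. exact/measurable_ev/auxS_rv. Qed.

Let mM t s m : measurable (ev (Mp U t s) m).
Proof. exact/measurable_ev/Mpot_rv. Qed.

Let intYp t m s : P.-integrable setT (EFin \o Yp U t m s).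
Proof. exact: Ypot_integrable. Qed.

(** Gives access to the randomization assumptions, which speak only of cells {A = a, X = x} of
    positive probability. *)
Let pr_experiment x a : experiment_assignment U ->
  0 < pr P (ev (covX U) x) -> 0 < pr P (ev (expA U) a `&` ev (covX U) x).
Proof.
move=> [_ _ pos] x0; have /andP[+ _] := pos x a x0.
by rewrite /cpr pmulr_lgt0// invr_gt0.
Qed.

Lemma mu_Y_potential t m x s :
  experiment_assignment U -> randomization_exp1 U -> consistency U ->
  0 < pr P (ev (covX U) x) ->
  mu_Y U t m x s = cexp P (Yp U t m s) (ev (covX U) x).
Proof.
move=> A3 [indTSM posTSM] [consY _] x0.
have [indA _ posA] := A3.
have a0 := pr_experiment x Exp1 A3 x0.
pose Z w := (trtT U w, auxS U w, medM U w).
have mZ : fin_rv Z.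
  apply: fin_rv_pair; last exact: medM_rv.
  by apply: fin_rv_pair; [exact: trtT_rv|exact: auxS_rv].
have ZE : ev Z (t, s, m) = ev (trtT U) t `&` ev (auxS U) s `&` ev (medM U) m.
  by rewrite !ev_pair.
pose K := ev (expA U) Exp1 `&` ev (covX U) x.
rewrite /mu_Y (_ : _ `&` _ = ev Z (t, s, m) `&` K); last first.
  by rewrite ZE; apply/seteqP; split=> w /=; rewrite /K /=; tauto.
(* On this event consistency turns the observed outcome into [Yp U t m s]. *)
rewrite (@eq_cexp _ _ _ P _ (Yp U t m s)); last first.
  by move=> w; rewrite inE => -[[<- <- <-] [a1 _]]; exact: consY.
(* Two conditions are dropped in turn: [Z] = (t, s, m) by randomization within the experiment, then
   A = 1 by experiment assignment. *)
rewrite cexp_indep//.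
- apply: cexp_indep => //; first by have /andP[] := posA x Exp1 x0.
  move=> E EY; have := indA t m s x; rewrite setTI; apply => //.
  exact: sigma_fin_ev.
- exact: measurable_ev.
- exact: measurableI.
- by have /andP[] := posTSM x t s m a0; rewrite ZE.
- move=> E EY; apply: (indTSM t m s x a0) => //; exact: sigma_fin_ev.
Qed.

Lemma e_med_potential t m x s :
  experiment_assignment U -> randomization_exp0 U -> consistency U ->
  0 < pr P (ev (covX U) x) ->
  e_med U m t x s = cpr P (ev (Mp U t s) m) (ev (covX U) x).
Proof.
move=> A3 [indTS posTS] [_ consM] x0.
have [_ indA posA] := A3.
have a0 := pr_experiment x Exp0 A3 x0.
pose Z w := (trtT U w, auxS U w).
have ZE : ev Z (t, s) = ev (trtT U) t `&` ev (auxS U) s by rewrite ev_pair.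
pose K := ev (expA U) Exp0 `&` ev (covX U) x.
rewrite /e_med (_ : _ `&` _ `&` _ `&` _ = ev Z (t, s) `&` K); last first.
  by rewrite ZE; apply/seteqP; split=> w /=; rewrite /K /=; tauto.
(* Only the numerator changes: where T = t, S = s and A = 0, consistency equates the observed
   mediator with [Mp U t s]. *)
have -> : cpr P (ev (medM U) m) (ev Z (t, s) `&` K)
    = cpr P (ev (Mp U t s) m) (ev Z (t, s) `&` K).
  congr (pr P _ / _); apply/seteqP; split=> w [Mm [[Tt Ss] [A0 Xx]]];
    have := consM w A0; rewrite Tt Ss => MMp.
    by split; [rewrite /ev /= -MMp|split; [congr pair|]].
  by split; [rewrite /ev /= MMp|split; [congr pair|]].
rewrite cpr_indep.
- apply: cpr_indep; first by have /andP[] := posA x Exp0 x0.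
  have := indA t s x; rewrite setTI; apply => //; exact: sigma_fin_ev.
- by have /andP[] := posTS x t s a0; rewrite ZE.
- by apply: (indTS t s x a0); exact: sigma_fin_ev.
Qed.

(** * Cell integrals and their sums *)

Hypothesis A1 : principal_ignorability U.
Hypothesis A3 : experiment_assignment U.
Hypothesis A4 : randomization_exp1 U.
Hypothesis A5 : randomization_exp0 U.
Hypothesis hcons : consistency U.

(** [integral_proportional] applies with constant Pr(M(t',s) = m | X = x); the remaining integral
    over {X = x} is a conditional mean times Pr(X = x). *)
Lemma integral_cell t t' m x s : 0 < pr P (ev (covX U) x) ->
  (\int[P]_(w in ev (covX U) x `&` ev (Mp U t' s) m) (Yp U t m s w)%:E
   = mu_Y U t m x s * (e_med U m t' x s)%:E * (pr P (ev (covX U) x))%:E)%E.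
Proof.
move=> x0; rewrite mu_Y_potential// e_med_potential// muleAC cexpK ?gt_eqF//.
rewrite muleC; apply: integral_proportional => //.
- exact: measurableI.
- by rewrite /cpr divr_ge0// pr_ge0.
(* The stratum lists the mediators at all treatment levels, so this is one of its events even when
   [t'] differs from [t]: the cross-world step. *)
move=> E EY; have MG : sigma_fin (stratum U) (ev (Mp U t' s) m).
  have -> : ev (Mp U t' s) m = stratum U @^-1` [set g | g (t', s) = m].
    by apply/seteqP; split=> w; rewrite /ev /stratum /= ffunE.
  exact: sigma_fin_preimage.
have := A1 t m s x; rewrite setTI => /(_ x0 _ _ EY MG) indM.
rewrite (setIC (ev (covX U) x)) setIA.
have K0 : pr P (ev (covX U) x) != 0 by rewrite gt_eqF.
rewrite -(divfK K0 (pr P (E `&` _ `&` _))) -/(cpr P (E `&` _) _) indM.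
by rewrite mulrAC [cpr P E _]/cpr divfK// mulrC.
Qed.

Lemma mean_nested_outcome t t' s :
  (\int[P]_w (Yp U t (Mp U t' s w) s w)%:E
   = \sum_(x | (0 < pr P (ev (covX U) x))%R) \sum_m
       mu_Y U t m x s * (e_med U m t' x s)%:E * (pr P (ev (covX U) x))%:E)%E.
Proof.
pose Z w := (covX U w, Mp U t' s w).
have mZ : fin_rv Z by apply: fin_rv_pair; [exact: covX_rv|exact: Mpot_rv].
rewrite (integral_partition P Z (fun v => Yp U t v.2 s))//.
transitivity (\sum_x \sum_m
    \int[P]_(w in ev (covX U) x `&` ev (Mp U t' s) m) (Yp U t m s w)%:E)%E.
  by rewrite pair_bigA; apply: eq_bigr => -[x m] _; rewrite ev_pair.
(* Values of [x] filtered out on the right count as 0 there; on the left their cells are null. *)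
rewrite [RHS]big_mkcond; apply: eq_bigr => x _.
case: ifPn => [x0|]; first by apply: eq_bigr => m _; exact: integral_cell.
rewrite lt_neqAle pr_ge0 andbT negbK eq_sym => /eqP x0.
rewrite big1// => m _; apply: (integral_null P _ (ev (covX U) x)) => //.
exact: measurableI.
Qed.

Lemma sigma_potentialI E F : sigma_potential U E -> sigma_potential U F ->
  sigma_potential U (E `&` F).
Proof. exact: (@measurableI _ (g_sigma_algebraType _)). Qed.

(** The cell and the events of Y(t,m,s) all lie in [sigma_potential U], so by independence cutting
    by {S = s'} only scales by its probability. *)
Lemma integral_aux_cell t m x s s' t' : aux_randomly_assigned U ->
  (\int[P]_(w in ev (auxS U) s' `&` (ev (covX U) x `&` ev (Mp U t' s) m))
      (Yp U t m s w)%:E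
   = (pr P (ev (auxS U) s'))%:E *
     \int[P]_(w in ev (covX U) x `&` ev (Mp U t' s) m) (Yp U t m s w)%:E)%E.
Proof.
move=> indS; apply: integral_proportional => //.
- by do 2 apply: measurableI => //.
- exact: measurableI.
- exact: pr_ge0.
move=> E EY; rewrite setICA; apply: indS; first exact: sigma_fin_ev.
apply: sigma_potentialI.
  by apply: sub_sigma_algebra; apply: Or32; exists t, m, s.
apply: sigma_potentialI; apply: sub_sigma_algebra.
  by apply: Or31; exact: sigma_fin_ev.
by apply: Or33; exists t', s; exact: sigma_fin_ev.
Qed.

Lemma alpha_f_identified (f : SS -> R) t t' :
  alpha_f U f t t'
  = (\sum_s \sum_(x | (0 < pr P (ev (covX U) x))%R) \sum_m
       mu_Y U t m x s * (e_med U m t' x s)%:E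
       * (pr P (ev (covX U) x))%:E * (f s)%:E)%E.
Proof.
apply: eq_bigr => s _; rewrite unlock mean_nested_outcome.
(* Distributing [f s] over sums of extended reals calls for finite summands. *)
have cell_fin m x : 0 < pr P (ev (covX U) x) ->
    (mu_Y U t m x s * (e_med U m t' x s)%:E
       * (pr P (ev (covX U) x))%:E)%E \is a fin_num.
  move=> x0; rewrite mu_Y_potential//; do 2 apply: fin_numM => //.
  exact: cexp_fin_num.
rewrite muleC fin_num_sume_distrr//; last first.
  move=> x x' x0 x0'; apply: fin_num_adde_defl.
  by apply/sum_fin_numP => m _ _; exact: cell_fin.
apply: eq_bigr => x x0; rewrite fin_num_sume_distrr//; last first.
  by move=> m m' _ _; apply: fin_num_adde_defl; exact: cell_fin.
by apply: eq_bigr => m _; rewrite muleC.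
Qed.

Lemma alpha_identified t t' : aux_randomly_assigned U ->
  alpha U t t'
  = (\sum_(x | (0 < pr P (ev (covX U) x))%R) \sum_s \sum_m
       mu_Y U t m x s * (e_med U m t' x s)%:E
       * (pr P (ev (covX U) x `&` ev (auxS U) s))%:E)%E.
Proof.
move=> indS; rewrite /alpha unlock.
(* The cells must also fix [S], since both the outcome and the mediator are read at it. *)
pose Z w := (covX U w, (auxS U w, Mp U t' (auxS U w) w)).
have mM' : fin_rv (fun w => Mp U t' (auxS U w) w).
  apply: (fin_rv_bind (auxS U) (fun s w => Mp U t' s w)); first exact: auxS_rv.
  by move=> s; exact: Mpot_rv.
have mZ : fin_rv Z.
  by do 2 (apply: fin_rv_pair; first by [exact: covX_rv|exact: auxS_rv]).
rewrite (integral_partition P Z (fun v => Yp U t v.2.2 v.2.1))//.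
transitivity (\sum_x \sum_s \sum_m
    \int[P]_(w in ev (auxS U) s `&` (ev (covX U) x `&` ev (Mp U t' s) m))
      (Yp U t m s w)%:E)%E.
  under [RHS]eq_bigr do rewrite pair_bigA.
  rewrite pair_bigA; apply: eq_bigr => -[x [s m]] _ /=; congr integral.
  rewrite ev_pair setICA; congr (_ `&` _); rewrite /ev.
  (* On {S = s} the mediator M(t',S) is M(t',s). *)
  by apply/seteqP; split=> w /= [<- <-].
rewrite [RHS]big_mkcond; apply: eq_bigr => x _.
case: ifPn => [x0|].
  apply: eq_bigr => s _; apply: eq_bigr => m _.
  rewrite integral_aux_cell// integral_cell// muleCA; congr (_ * _)%E.
  (* Independence of [S] and [X] merges Pr(S = s) Pr(X = x) into the joint probability. *)
  rewrite -EFinM setIC; congr EFin; apply/esym/indS; first exact: sigma_fin_ev.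
  by apply: sub_sigma_algebra; apply: Or31; exact: sigma_fin_ev.
rewrite lt_neqAle pr_ge0 andbT negbK eq_sym => /eqP x0.
rewrite big1// => s _; rewrite big1// => m _.
apply: (integral_null P _ (ev (covX U) x)) => //.
  by do 2 apply: measurableI => //.
by move=> w [_ []].
Qed.

End Identification.

Theorem mainTheorem1 (d : measure_display) (Omega : measurableType d)
    (R : realType) (P : probability Omega R) (XX TT MM SS : finType)
    (U : unit_data P XX TT MM SS)
    (A1 : principal_ignorability U)
    (A2 : exclusion_restriction U)
    (A3 : experiment_assignment U)
    (A4 : randomization_exp1 U)
    (A5 : randomization_exp0 U)
    (hcons : consistency U) :
  (forall (f : SS -> R), is_distribution f -> forall t t' : TT,
     alpha_f U f t t'
     = (\sum_s \sum_(x | (0 < pr P (ev (covX U) x))%R) \sum_m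
          mu_Y U t m x s * (e_med U m t' x s)%:E
          * (pr P (ev (covX U) x))%:E * (f s)%:E)%E)
  /\
  (aux_randomly_assigned U -> forall t t' : TT,
     alpha U t t'
     = (\sum_(x | (0 < pr P (ev (covX U) x))%R) \sum_s \sum_m
          mu_Y U t m x s * (e_med U m t' x s)%:E
          * (pr P (ev (covX U) x `&` ev (auxS U) s))%:E)%E).
Proof.
split=> [f _ t t'|indS t t']; first exact: alpha_f_identified.
exact: alpha_identified.
Qed.
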